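(* Let $\lambda,\mu$ be integer partitions with $\lambda_i\ge\mu_i$ for all $i$, and let $\mathbf{w},\mathbf{w}'$ be integer compositions with $\mathbf{w}'<_{\mathrm{ref}}\mathbf{w}$. Let $P=\mathcal{P}_{\lambda/\mu,\mathbf{w}}\subset\mathbb{R}^d$ and $P'=\mathcal{P}_{\lambda/\mu,\mathbf{w}'}\subset\mathbb{R}^{d'}$. Then: (1) $|P'\cap\mathbb{Z}^{d'}|\ge|P\cap\mathbb{Z}^d|$; (2) if $P'$ is empty then $P$ is empty; (3) if $P'$ is integral then $P$ is integral; (4) if $P'$ has the integer decomposition property then so does $P$.
   Context: An integer composition is a finite sequence of positive integers. $\mathbf{w}'\le_{\mathrm{ref}}\mathbf{w}$ means $\mathbf{w}'$ is a refinement of $\mathbf{w}$, i.e. $\mathbf{w}$ is obtained from $\mathbf{w}'$ by adding together consecutive blocks of parts; $<_{\mathrm{ref}}$ is the strict version. For a composition $\mathbf{w}=(w_1,\dots,w_{m-1})$, a Gelfand--Tsetlin (GT) pattern is a real array $(x^i_j)_{1\le i\le m,\,1\le j\le n}$ ($n$ at least the length of $\lambda$, partitions padded with zeros) with $x^{i+1}_j\ge x^i_j$ and $x^i_j\ge x^{i+1}_{j+1}$ whenever defined; $\mathcal{P}_{\lambda/\mu,\mathbf{w}}\subset\mathbb{R}^{mn}$ is the polytope of GT patterns with $\mathbf{x}^m=\lambda$, $\mathbf{x}^1=\mu$, and $\sum_jx^{i+1}_j-\sum_jx^i_j=w_i$ for $i=1,\dots,m-1$. A polytope is integral if all its vertices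 are lattice points. An integral polytope $Q\subset\mathbb{R}^d$ has the integer decomposition property (IDP) if for every positive integer $k$ and every $\mathbf{x}\in kQ\cap\mathbb{Z}^d$ there are $\mathbf{x}^1,\dots,\mathbf{x}^k\in Q\cap\mathbb{Z}^d$ with $\mathbf{x}^1+\dots+\mathbf{x}^k=\mathbf{x}$. Note $k\mathcal{P}_{\lambda/\mu,\mathbf{w}}=\mathcal{P}_{k\lambda/k\mu,k\mathbf{w}}$. *)

(* Defs.v *)
From mathcomp Require Import all_boot all_order all_algebra.
From mathcomp Require Import all_classical all_reals.

Set Implicit Arguments.
Unset Strict Implicit.
Unset Printing Implicit Defensive.

Import Order.TTheory GRing.Theory Num.Theory.

Local Open Scope classical_set_scope.
Local Open Scope ring_scope.

(* Finite list of parts without trailing zeros, so that [size] is the length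
   of the partition; [nth 0 lam] pads with zeros. *)
Definition is_partition (lam : seq nat) : bool :=
  sorted geq lam && (0%N \notin lam).

Definition is_composition (w : seq nat) : bool := 0%N \notin w.

Definition refines (w' w : seq nat) : Prop :=
  exists blocks : seq (seq nat),
    [/\ [::] \notin blocks, w' = flatten blocks & w = map sumn blocks].

Definition strictly_refines (w' w : seq nat) : Prop :=
  refines w' w /\ w' <> w.

Section Polytopes.
Variables (R : realType) (m n : nat).

(* R^(mn) is represented by m x n matrices. *)
Definition lattice : set 'M[R]_(m, n) := [set x | x \is a mxOver Num.int].

Definition dilate (k : nat) (Q : set 'M[R]_(m, n)) : set 'M[R]_(m, n) :=
  [set k%:R *: x | x in Q].

(* The vertices of a polytope are its extreme points. *)
Definition vertex (Q : set 'M[R]_(m, n)) (v : 'M[R]_(m, n)) : Prop :=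
  Q v /\
  forall (x y : 'M[R]_(m, n)) (t : R), Q x -> Q y -> 0 < t < 1 ->
    v = t *: x + (1 - t) *: y -> x = y.

Definition integral_polytope (Q : set 'M[R]_(m, n)) : Prop :=
  forall v, vertex Q v -> lattice v.

Definition has_IDP (Q : set 'M[R]_(m, n)) : Prop :=
  integral_polytope Q /\
  forall (k : nat) (x : 'M[R]_(m, n)), (0 < k)%N ->
    (dilate k Q `&` lattice) x ->
    exists y : 'I_k -> 'M[R]_(m, n),
      (forall l, (Q `&` lattice) (y l)) /\ \sum_(l < k) y l = x.

(* [x i j] is the entry x^(i+1)_(j+1) in 1-based notation. *)
Definition GT_pattern (x : 'M[R]_(m, n)) : Prop :=
  (forall (i i' : 'I_m) (j : 'I_n), i' = i.+1 :> nat -> x i j <= x i' j) /\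
  (forall (i i' : 'I_m) (j j' : 'I_n),
     i' = i.+1 :> nat -> j' = j.+1 :> nat -> x i' j' <= x i j).

End Polytopes.

Definition GT_polytope (R : realType) (n : nat) (lam mu w : seq nat) :
    set 'M[R]_((size w).+1, n) :=
  [set x | [/\ GT_pattern x,
      forall j : 'I_n, x ord_max j = (nth 0%N lam j)%:R,
      forall j : 'I_n, x ord0 j = (nth 0%N mu j)%:R &
      forall i i' : 'I_(size w).+1, i' = i.+1 :> nat ->
        \sum_(j < n) x i' j - \sum_(j < n) x i j = (nth 0%N w i)%:R]].

Arguments lattice : clear implicits.
Arguments GT_polytope : clear implicits.

(* Main.v *)
Require Import Defs.
From mathcomp Require Import all_boot all_order all_algebra.
From mathcomp Require Import all_classical all_reals.
From mathcomp Require Import zify ring lra.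

Set Implicit Arguments.
Unset Strict Implicit.
Unset Printing Implicit Defensive.

Import Order.TTheory GRing.Theory Num.Theory.

Local Open Scope classical_set_scope.
Local Open Scope card_scope.
Local Open Scope ring_scope.

(** It is enough to merge two consecutive parts [a], [b] of [w'] into [a + b].
    Between two consecutive rows [x <= z] of a pattern of weight [a + b], insert
    the row [y] obtained by adding the amount [a] to [x] greedily from the right:
    [y j = x j] for [j < p] and [y j = z j] for [j > p]. For fixed [p] these
    equations cut out a face of [P'], and deleting the row [y] maps that face
    injectively and integrally into [P]. Hence [P] is the union over [p] of these
    images: an extreme point of [P] comes from an extreme point of [P'], and a
    decomposition of the filled pattern in [k P'] stays in the face, so it projects
    to a decomposition in [k P]. *)

(** Induction from the left: coordinate [0] receives only what the other coordinates cannot absorb.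
    Values arise from the data by sums and differences alone, which keeps them integral. For [a = 0]
    the construction returns [p = n] and [y = x]. *)
Lemma greedy_fill (R : archiRealFieldType) (n : nat) (x z : 'I_n -> R) (a : R) :
  (forall j, x j <= z j) -> 0 <= a <= \sum_(j < n) (z j - x j) ->
  exists (p : nat) (y : 'I_n -> R),
    [/\ forall j : 'I_n, (j < p)%N -> y j = x j,
        forall j : 'I_n, (p < j)%N -> y j = z j,
        forall j, x j <= y j <= z j,
        \sum_(j < n) y j = \sum_(j < n) x j + a &
        (forall j, x j \is a Num.int) -> (forall j, z j \is a Num.int) ->
        a \is a Num.int -> forall j, y j \is a Num.int].
Proof.
elim: n x z => [|n IHn] x z le_xz.
  rewrite !big_ord0 => a0; exists 0%N, x.
  by split=> [//|[]//|[]//||//]; rewrite !big_ord0; lra.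
rewrite big_ord_recl => /andP[a_ge0 a_le].
pose cons c (y : 'I_n -> R) i := if unlift ord0 i is Some j then y j else c.
have cons0 c y : cons c y ord0 = c by rewrite /cons unlift_none.
have consS c y j : cons c y (lift ord0 j) = y j by rewrite /cons liftK.
set tail := \sum_(j < n) _ in a_le.
have [le_a|lt_a] := leP a tail.
  have [|p [y [yl yr yb ys yi]]] :=
    IHn (x \o lift ord0) (z \o lift ord0) (fun j => le_xz _).
    by rewrite a_ge0.
  exists p.+1, (cons (x ord0) y); split.
  - by move=> j; case: (unliftP ord0 j) => [j'|] ->; rewrite ?cons0 // consS => /yl.
  - by move=> j; case: (unliftP ord0 j) => [j'|] ->; rewrite ?cons0 // consS => /yr.
  - move=> j; case: (unliftP ord0 j) => [j'|] ->; rewrite ?consS ?cons0 ?lexx ?le_xz //.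
    exact: yb.
  - rewrite !big_ord_recl cons0; under eq_bigr do rewrite consS.
    by rewrite ys addrA.
  - move=> xi zi ai j; case: (unliftP ord0 j) => [j'|] ->; rewrite ?cons0 // consS.
    by apply: yi => // ?; [apply: xi|apply: zi].
(* All later coordinates are full, so the pivot is [0] and takes the excess [a - tail]. *)
exists 0%N, (cons (x ord0 + (a - tail)) (z \o lift ord0)); split=> //.
- by move=> j; case: (unliftP ord0 j) => [j'|] ->; rewrite ?consS.
- move=> j; case: (unliftP ord0 j) => [j'|] ->; rewrite ?consS ?cons0 /= ?lexx ?le_xz //.
  by apply/andP; split; lra.
- rewrite !big_ord_recl cons0; under eq_bigr do rewrite consS.
  by rewrite /tail sumrB /=; ring.
- move=> xi zi ai j; case: (unliftP ord0 j) => [j'|] ->; rewrite ?consS ?cons0 ?zi //=.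
  by rewrite rpredD ?rpredB ?rpred_sum // => i _; rewrite rpredB.
Qed.

(** * Patterns with real boundary rows and weights, and their dilates *)

Section GTSet.
Variables (R : realType) (n : nat).

(* Real data make the family stable under dilation. *)
Definition GT_set (m : nat) (lam mu : 'I_n -> R) (wt : nat -> R) :
    set 'M[R]_(m.+1, n) :=
  [set x | [/\ GT_pattern x,
      forall j, x ord_max j = lam j,
      forall j, x ord0 j = mu j &
      forall i i' : 'I_m.+1, i' = i.+1 :> nat ->
        \sum_(j < n) x i' j - \sum_(j < n) x i j = wt i]].

Lemma GT_setZ (m : nat) (c : R) (lam mu : 'I_n -> R) (wt : nat -> R)
    (x : 'M[R]_(m.+1, n)) :
  0 <= c -> GT_set lam mu wt x ->
  GT_set (fun j => c * lam j) (fun j => c * mu j) (fun i => c * wt i) (c *: x).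
Proof.
move=> c_ge0 [[xv xd] xl xm xw]; split.
- split=> [i i' j|i i' j j'] /=; rewrite !mxE => ii'.
    by apply: ler_wpM2l; last exact: xv.
  by move=> jj'; apply: ler_wpM2l; last exact: xd.
- by move=> j; rewrite mxE xl.
- by move=> j; rewrite mxE xm.
- move=> i i' ii'; rewrite -(xw _ _ ii') mulrBr !mulr_sumr.
  by congr (_ - _); apply: eq_bigr => j _; rewrite mxE.
Qed.

Lemma dilate_GT_set (m k : nat) (lam mu : 'I_n -> R) (wt : nat -> R) :
  (0 < k)%N ->
  dilate k (@GT_set m lam mu wt) =
  @GT_set m (fun j => k%:R * lam j) (fun j => k%:R * mu j) (fun i => k%:R * wt i).
Proof.
move=> k_gt0; have k0 : k%:R != 0 :> R by rewrite pnatr_eq0 -lt0n.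
apply/seteqP; split=> [_ [x xP <-]|x xP]; first exact: GT_setZ.
exists (k%:R^-1 *: x); last by rewrite scalerA divff // scale1r.
have := @GT_setZ m k%:R^-1 _ _ _ x; rewrite invr_ge0 ler0n => /(_ _ _ _ isT xP).
by congr (GT_set _ _ _ _); apply/funext => i; rewrite mulKf.
Qed.

End GTSet.

(** * Inserting and deleting the row [h] between [lo] and [hi] *)

Section InsertRow.
Variables (R : realType) (m n : nat) (lo h hi : 'I_m.+2).
Hypotheses (h_lo : h = lo.+1 :> nat) (hi_h : hi = h.+1 :> nat).

Definition greedy_face (p : nat) (x : 'M[R]_(m.+2, n)) : Prop :=
  (forall j : 'I_n, (j < p)%N -> x h j = x lo j) /\
  (forall j : 'I_n, (p < j)%N -> x h j = x hi j).

Lemma lift_max : lift h ord_max = ord_max :> 'I_m.+2.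
Proof. apply/val_inj; rewrite /= /bump; have := ltn_ord hi; lia. Qed.

Lemma lift_min : lift h ord0 = ord0 :> 'I_m.+2.
Proof. by apply/val_inj; rewrite /= /bump; lia. Qed.

Lemma lift_lo (i : 'I_m.+1) : i = lo :> nat -> lift h i = lo.
Proof. by move=> il; apply/val_inj; rewrite /= /bump; lia. Qed.

Lemma lift_hi (i : 'I_m.+1) : i = h :> nat -> lift h i = hi.
Proof. by move=> il; apply/val_inj; rewrite /= /bump; lia. Qed.

Lemma lift_succ (i i' : 'I_m.+1) :
  i <> lo :> nat -> (i' = i.+1 :> nat) <-> (lift h i' = (lift h i).+1 :> nat).
Proof. by rewrite /= /bump; lia. Qed.

Section Weights.
Variables (lam mu : 'I_n -> R) (wt wt' : nat -> R).
Hypotheses (wt_lo : wt lo = wt' lo + wt' h)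
  (wtE : forall i, i <> lo :> nat -> wt i = wt' (bump h i)).

(* Filling from the right is what makes the second family of inequalities
   survive: [x lo j >= x hi j.+1] is inherited from [x h j >= x hi j.+1] left of
   [p] and from [x lo j >= x h j.+1] elsewhere. *)
Lemma GT_set_delete_row (p : nat) (x : 'M[R]_(m.+2, n)) :
  GT_set lam mu wt' x -> greedy_face p x ->
  GT_set lam mu wt (rowsub (lift h) x).
Proof.
move=> [[xv xd] xl xm xw] [fl fr]; split.
- split=> [i i' j|i i' j j'] ii'.
    rewrite !mxE; have [il|/eqP il] := eqVneq (i : nat) lo; last exact/xv/lift_succ.
    rewrite (lift_lo il) lift_hi; last by rewrite ii' il.
    exact: le_trans (xv _ _ _ h_lo) (xv _ _ _ hi_h).
  move=> jj'; rewrite !mxE; have [il|/eqP il] := eqVneq (i : nat) lo.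
    rewrite (lift_lo il) lift_hi; last by rewrite ii' il.
    have [jp|pj] := ltnP j p; first by rewrite -fl //; exact: xd.
    by rewrite -fr ?jj' //; apply: xd.
  by apply: xd => //; apply/lift_succ.
- by move=> j; rewrite mxE lift_max.
- by move=> j; rewrite mxE lift_min.
- move=> i i' ii'; have rsE k : \sum_(j < n) rowsub (lift h) x k j =
      \sum_(j < n) x (lift h k) j by apply: eq_bigr => j _; rewrite mxE.
  rewrite !rsE; have [il|/eqP il] := eqVneq (i : nat) lo.
    rewrite (lift_lo il) lift_hi; last by rewrite ii' il.
    by rewrite il wt_lo -(xw _ _ h_lo) -(xw _ _ hi_h); ring.
  by rewrite wtE // (xw _ _ ((lift_succ _ il).1 ii')).
Qed.

(** The new row is the greedy filling by the amount [wt' lo]. It fits because the total gap between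
    the two old rows is [wt' lo + wt' h] and [wt' h] is nonnegative. *)
Lemma GT_set_insert_row (x : 'M[R]_(m.+1, n)) :
  0 <= wt' lo -> 0 <= wt' h -> GT_set lam mu wt x ->
  exists p (x' : 'M[R]_(m.+2, n)),
    [/\ GT_set lam mu wt' x', greedy_face p x',
        rowsub (lift h) x' = x &
        wt' lo \is a Num.int -> lattice R m.+1 n x -> lattice R m.+2 n x'].
Proof.
move=> wlo_ge0 wh_ge0 [[xv xd] xl xm xw].
have lo_lt : (lo < m.+1)%N by have := ltn_ord hi; lia.
have h_lt : (h < m.+1)%N by have := ltn_ord hi; lia.
pose l := Ordinal lo_lt; pose u := Ordinal h_lt.
have lE : lift h l = lo by exact: lift_lo.
have uE : lift h u = hi by exact: lift_hi.
have ul : u = l.+1 :> nat by [].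
have [|p [y [yl yr yb ys yi]]] :=
  @greedy_fill R n (x l) (x u) (wt' lo) (fun j => xv _ _ j ul).
  by rewrite wlo_ge0 sumrB (xw _ _ ul) /= wt_lo; lra.
pose x' := \matrix_(i < m.+2, j < n)
  (if unlift h i is Some i0 then x i0 j else y j).
have x'h j : x' h j = y j by rewrite mxE unlift_none.
have x'L i j : x' (lift h i) j = x i j by rewrite mxE liftK.
have x'lo j : x' lo j = x l j by rewrite -lE x'L.
have x'hi j : x' hi j = x u j by rewrite -uE x'L.
(* Consecutive rows either involve the new row or were already consecutive; the pair [lo], [hi] is
   now separated. *)
have succ_cases (i i' : 'I_m.+2) : i' = i.+1 :> nat ->
    [\/ i = lo /\ i' = h, i = h /\ i' = hi |
        exists i0 i0', [/\ i = lift h i0, i' = lift h i0', i0 <> lo :> nat &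
          i0' = i0.+1 :> nat]].
  move=> ii'; case: (unliftP h i) => [i0|] iE.
    case: (unliftP h i') => [i0'|] i'E.
      apply: Or33; exists i0, i0'; split=> //; first last.
        by move: ii'; rewrite iE i'E /= /bump; lia.
      by move: ii'; rewrite iE i'E /= /bump; lia.
    apply: Or31; split=> //; apply/val_inj; move: ii'; rewrite i'E /=; lia.
  by apply: Or32; split=> //; apply/val_inj; rewrite /= ii' iE hi_h.
exists p, x'; split.
- split.
  + split=> [i i' j|i i' j j'] /succ_cases[[-> ->]|[-> ->]|[i0 [i0' [-> -> _ ii']]]];
      rewrite ?x'L ?x'lo ?x'h ?x'hi; try (by case/andP: (yb j)); try exact: xv.
    (* Both diagonal inequalities at the new row follow from the old one between rows [l] and [u],
       since [y] lies between these rows. *)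
    * by move=> jj'; case/andP: (yb j') => _ /le_trans; apply; exact: xd.
    * by move=> jj'; case/andP: (yb j) => + _; apply: le_trans; exact: xd.
    * by move=> jj'; exact: xd.
  + by move=> j; rewrite -lift_max x'L.
  + by move=> j; rewrite -lift_min x'L.
  + move=> i i' /succ_cases[[-> ->]|[-> ->]|[i0 [i0' [-> -> il ii']]]].
    * rewrite (eq_bigr _ (fun j _ => x'h j)) (eq_bigr _ (fun j _ => x'lo j)) ys.
      by ring.
    * rewrite (eq_bigr _ (fun j _ => x'h j)) (eq_bigr _ (fun j _ => x'hi j)) ys.
      by have := xw _ _ ul; rewrite /= wt_lo; lra.
    * rewrite (eq_bigr _ (fun j _ => x'L i0 j)) (eq_bigr _ (fun j _ => x'L i0' j)).
      by rewrite (xw _ _ ii') wtE.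
- by split=> j jp; rewrite x'h ?x'lo ?x'hi; [exact: yl|exact: yr].
- by apply/matrixP => i j; rewrite mxE x'L.
- move=> wi /mxOverP xi; apply/mxOverP => i j; rewrite mxE.
  by case: unliftP => [i0|] _ //; apply: yi.
Qed.

(** On the face, row [h] copies its neighbours except in column [p], and the weight at [lo] fixes
    its sum, hence the last entry. *)
Lemma rowsub_lift_inj (p : nat) (x y : 'M[R]_(m.+2, n)) :
  GT_set lam mu wt' x -> GT_set lam mu wt' y ->
  greedy_face p x -> greedy_face p y ->
  rowsub (lift h) x = rowsub (lift h) y -> x = y.
Proof.
move=> [_ _ _ xw] [_ _ _ yw] [xl xr] [yl yr] /matrixP exy.
have E i j : i != h -> x i j = y i j.
  case: (unliftP h i) => [i0 ->|->]; rewrite ?eqxx // => _.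
  by have := exy i0 j; rewrite !mxE.
have nlo : lo != h by apply/eqP => /(congr1 val) /=; lia.
have nhi : hi != h by apply/eqP => /(congr1 val) /=; lia.
have Eh (j : 'I_n) : (j != p :> nat) -> x h j = y h j.
  by rewrite neq_ltn => /orP[jp|jp]; [rewrite xl ?yl ?E|rewrite xr ?yr ?E].
apply/matrixP => i j; have [->|/E//] := eqVneq i h.
have [jp|/Eh//] := eqVneq (j : nat) p.
have := xw _ _ h_lo; rewrite -(yw _ _ h_lo).
have -> : \sum_(k < n) x lo k = \sum_(k < n) y lo k.
  by apply: eq_bigr => k _; exact: E.
move/addIr; rewrite (bigD1 j) // [in RHS](bigD1 j) //=.
rewrite (eq_bigr (y h)) => [|k kj]; first by move/addIr.
apply: Eh.
by rewrite -jp; apply: contra kj => /eqP/val_inj ->.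
Qed.

End Weights.

(** Each face equation is the equality case of a pattern inequality, and a sum of nonnegative terms
    vanishes only termwise. The coefficients need not sum to [1], so both convex combinations and
    plain sums are covered. *)
Lemma greedy_face_sum (I : finType) (c : I -> R) (p : nat)
    (x : I -> 'M[R]_(m.+2, n)) :
  (forall l, 0 < c l) -> (forall l, GT_pattern (x l)) ->
  greedy_face p (\sum_l c l *: x l) -> forall l, greedy_face p (x l).
Proof.
move=> c_gt0 xP [fl fr] l.
have sumE i j : (\sum_l c l *: x l) i j = \sum_l c l * x l i j.
  by rewrite summxE; apply: eq_bigr => k _; rewrite mxE.
have eq_row (i i' : 'I_m.+2) j : i' = i.+1 :> nat ->
    (\sum_l c l *: x l) i j = (\sum_l c l *: x l) i' j -> x l i j = x l i' j.
  move=> ii'; rewrite !sumE => /esym/eqP; rewrite -subr_eq0 -sumrB => /eqP.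
  have ge0 k : true -> 0 <= c k * x k i' j - c k * x k i j.
    by move=> _; rewrite -mulrBr pmulr_rge0 ?c_gt0 // subr_ge0; apply: (xP k).1.
  move=> /(psumr_eq0P ge0)/(_ l isT)/eqP.
  by rewrite -mulrBr mulf_eq0 gt_eqF //= subr_eq0 => /eqP.
by split=> j jp; [apply/esym/eq_row => //; rewrite fl|apply: eq_row => //; rewrite fr].
Qed.

End InsertRow.

(** * Transfer of the four properties along a single merge *)

Definition transfers (R : realType) (m m' n : nat) (P : set 'M[R]_(m, n))
    (P' : set 'M[R]_(m', n)) : Prop :=
  [/\ (P `&` lattice R m n) #<= (P' `&` lattice R m' n),
      P' = set0 -> P = set0,
      integral_polytope P' -> integral_polytope P &
      has_IDP P' -> has_IDP P].

Lemma transfers_refl (R : realType) (m n : nat) (P : set 'M[R]_(m, n)) :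
  transfers P P.
Proof. by split. Qed.

(** Reduces a refinement to a chain of merges of two adjacent parts. *)
Lemma transfers_trans (R : realType) (m1 m2 m3 n : nat) (P1 : set 'M[R]_(m1, n))
    (P2 : set 'M[R]_(m2, n)) (P3 : set 'M[R]_(m3, n)) :
  transfers P1 P2 -> transfers P2 P3 -> transfers P1 P3.
Proof.
move=> [c12 e12 i12 d12] [c23 e23 i23 d23]; split.
- exact: card_le_trans c12 c23.
- by move=> /e23/e12.
- by move=> /i23/i12.
- by move=> /d23/d12.
Qed.

(** The equation [m' = m.+1] is a hypothesis because the sizes of the lists to which this is applied
    are not convertible to that form. Natural weights make the filled amount an integer, also after
    dilation. *)
Lemma GT_set_transfers (R : realType) (m m' n k : nat) (lam mu : 'I_n -> R)
    (wt wt' : nat -> nat) :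
  m' = m.+1 -> (k < m)%N -> wt k = (wt' k + wt' k.+1)%N ->
  (forall i, i <> k -> wt i = wt' (bump k.+1 i)) ->
  transfers (@GT_set R n m lam mu (fun i => (wt i)%:R))
    (@GT_set R n m' lam mu (fun i => (wt' i)%:R)).
Proof.
move=> -> {m'} km wtk wtE.
(* Since [k < m], all three indices are below [m.+2] and [inord] never takes its default value. *)
pose lo : 'I_m.+2 := inord k; pose h : 'I_m.+2 := inord k.+1.
pose hi : 'I_m.+2 := inord k.+2.
have loE : lo = k :> nat by rewrite inordK; lia.
have hE : h = k.+1 :> nat by rewrite inordK; lia.
have hiE : hi = k.+2 :> nat by rewrite inordK; lia.
have h_lo : h = lo.+1 :> nat by rewrite hE loE.
have hi_h : hi = h.+1 :> nat by rewrite hE hiE.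
set P := GT_set _ _ _; set P' := GT_set _ _ _.
have proj p (x : 'M[R]_(m.+2, n)) :
    P' x -> greedy_face lo h hi p x -> P (rowsub (lift h) x).
  apply: (GT_set_delete_row h_lo hi_h).
    by rewrite loE hE wtk natrD.
  by move=> i; rewrite loE hE => /wtE ->.
(* Stated for dilates because the decomposition property starts from a point of [dilate q P];
   [q = 1] gives [P] itself. *)
have ins (q : nat) x : (0 < q)%N -> dilate q P x ->
    exists p x', [/\ dilate q P' x', greedy_face lo h hi p x', rowsub (lift h) x' = x &
      lattice R m.+1 n x -> lattice R m.+2 n x'].
  move=> q_gt0; rewrite !dilate_GT_set //.
  case/(GT_set_insert_row h_lo hi_h (wt' := fun i => q%:R * (wt' i)%:R)).
  - by rewrite loE hE wtk natrD mulrDr.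
  - by move=> i; rewrite loE hE => /wtE ->.
  - by rewrite -natrM ler0n.
  - by rewrite -natrM ler0n.
  move=> p [x' [x'P x'f x'x x'i]]; exists p, x'; split=> //.
  by apply: x'i; rewrite -natrM rpred_nat.
have dil1 (m0 : nat) (Q : set 'M[R]_(m0, n)) : dilate 1 Q = Q.
  rewrite /dilate; under eq_imagel do rewrite scale1r.
  by rewrite image_id.
have ins1 x : P x -> exists p x', [/\ P' x', greedy_face lo h hi p x',
    rowsub (lift h) x' = x & lattice R m.+1 n x -> lattice R m.+2 n x'].
  by have := ins 1%N x isT; rewrite !dil1.
have proj_lattice (x : 'M[R]_(m.+2, n)) :
    lattice R m.+2 n x -> lattice R m.+1 n (rowsub (lift h) x).
  by move=> /mxOverP xi; apply/mxOverP => i j; rewrite mxE.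
have intP : integral_polytope P' -> integral_polytope P.
  move=> P'int v [vP v_ext]; have [p [v' [v'P' v'f v'v _]]] := ins1 v vP.
  rewrite -v'v; apply/proj_lattice/P'int; split=> // x y t xP' yP' t01 v'E.
  (* The two ends of a segment through [v'] lie in its face, so they project into [P], where
     extremality of [v] identifies their images. *)
  have xyf (b : bool) : greedy_face lo h hi p (if b then x else y).
    apply: (greedy_face_sum h_lo hi_h (c := fun b : bool => if b then t else 1 - t)
      (x := fun b : bool => if b then x else y)).
    - by case; lra.
    - by case; [case: xP'|case: yP'].
    - by rewrite big_bool /= -v'E.
  have := xyf false; have := xyf true => /= xf yf.
  apply: (rowsub_lift_inj h_lo hi_h xP' yP' xf yf).
  apply: (v_ext _ _ t) => //; [exact: proj xf|exact: proj yf|].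
  by rewrite -v'v v'E; apply/matrixP => i j; rewrite !mxE.
split=> //.
(* The image may leave [P], as deletion is controlled only on the faces; it suffices that it covers
   the lattice points of [P]. *)
- apply: (@card_le_trans _ _ _ (rowsub (lift h) @` (P' `&` lattice R m.+2 n))).
    apply: subset_card_le => x [/ins1[p [x' [x'P' _ x'x x'i]]] xi].
    by exists x' => //; split=> //; exact: x'i.
  exact: card_image_le.
- by move=> P'0; apply/seteqP; split=> // x /ins1[p [x' [+ _ _ _]]]; rewrite P'0.
- move=> [P'int P'idp]; split; first exact: intP.
  move=> q x q_gt0 [/ins -/(_ q_gt0)[p [x' [x'P' x'f x'x x'i]]] xi].
  have [y' [y'P' y's]] := P'idp q x' q_gt0 (conj x'P' (x'i xi)).
  (* All summands share the face of [x'], so deleting row [h] from each gives points of [P]. *)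
  have y'f l : greedy_face lo h hi p (y' l).
    apply: (greedy_face_sum h_lo hi_h (c := fun=> 1)).
    - by move=> _; exact: ltr01.
    - by move=> l0; case: (y'P' l0) => [[]].
    - by under eq_bigr do rewrite scale1r; rewrite y's.
  exists (fun l => rowsub (lift h) (y' l)); split.
    move=> l; have [y'P y'i] := y'P' l; split; last exact: proj_lattice.
    exact: proj (y'f l).
  rewrite -x'x -y's; apply/matrixP => i j; rewrite mxE !summxE.
  by apply: eq_bigr => l _; rewrite mxE.
Qed.

(** * From one merge to an arbitrary refinement *)

Lemma GT_polytope_transfers_merge (R : realType) (n : nat) (lam mu s t : seq nat)
    (a b : nat) :
  transfers (GT_polytope R n lam mu (s ++ (a + b)%N :: t))
    (GT_polytope R n lam mu (s ++ a :: b :: t)).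
Proof.
apply: (GT_set_transfers (k := size s)).
- by rewrite !size_cat /= !addnS.
- by rewrite size_cat /=; lia.
- by rewrite !nth_cat ltnn ltnNge leqnSn /= subnn subSnn.
(* Before position [size s] the two lists agree; after it the merged list lags by one place, which
   is the shift made by [bump]. *)
- move=> i /eqP; rewrite neq_ltn => /orP[lt_i|lt_i].
    by rewrite /bump leqNgt ltnS (ltnW lt_i) /= add0n !nth_cat lt_i.
  rewrite /bump lt_i add1n !nth_cat !ltnNge (ltnW lt_i) (ltnW (leqW lt_i)) /=.
  by rewrite subSn ?(ltnW lt_i) // -(subnSK lt_i).
Qed.

Lemma GT_polytope_transfers_block (R : realType) (n : nat)
    (lam mu s t b : seq nat) (a : nat) :
  transfers (GT_polytope R n lam mu (s ++ sumn (a :: b) :: t))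
    (GT_polytope R n lam mu (s ++ (a :: b) ++ t)).
Proof.
elim: b a => [|b bs IHb] a /=; first by rewrite addn0; apply: transfers_refl.
have := IHb (a + b)%N; rewrite /= -addnA => /transfers_trans; apply.
exact: GT_polytope_transfers_merge.
Qed.

Lemma GT_polytope_transfers_refines (R : realType) (n : nat)
    (lam mu w w' : seq nat) :
  refines w' w ->
  transfers (GT_polytope R n lam mu w) (GT_polytope R n lam mu w').
Proof.
(* The prefix [s] collects the sums of earlier blocks, so the induction splits the later blocks
   while the current one is still summed. *)
move=> [bs [+ -> ->]]; suff gen s : [::] \notin bs ->
    transfers (GT_polytope R n lam mu (s ++ map sumn bs))
      (GT_polytope R n lam mu (s ++ flatten bs)) by exact: (gen [::]).
elim: bs s => [|b bs IHb] s; first by move=> _; apply: transfers_refl.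
rewrite inE negb_or => /andP[b0 bsP].
case: b b0 => [//|a b _].
have := IHb (rcons s (sumn (a :: b))) bsP; rewrite !cat_rcons.
move/transfers_trans; apply.
exact: GT_polytope_transfers_block.
Qed.

Theorem mainTheorem3 (R : realType) (n : nat) (lam mu w w' : seq nat)
    (lam_part : is_partition lam) (mu_part : is_partition mu)
    (mu_sub_lam : forall i : nat, (nth 0%N mu i <= nth 0%N lam i)%N)
    (w_comp : is_composition w) (w'_comp : is_composition w')
    (w'_ref_w : strictly_refines w' w)
    (n_ge : (size lam <= n)%N) :
  let P := GT_polytope R n lam mu w in
  let P' := GT_polytope R n lam mu w' in
  [/\ (P `&` lattice R (size w).+1 n)
        #<= (P' `&` lattice R (size w').+1 n),
      P' = set0 -> P = set0,
      integral_polytope P' -> integral_polytope P &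
      has_IDP P' -> has_IDP P].
Proof. by case: w'_ref_w => /GT_polytope_transfers_refines ref _; apply: ref. Qed.
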